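(* A curve $\alpha$ in $\mathbb{R}^3$, parametrized by arc length $s$ on an open interval $I$, is a slant helix if and only if, up to a rigid motion of $\mathbb{R}^3$, $$\alpha(s)=\left(\int R\cos\Theta\,ds,\ \pm\int R\sin\Theta\,ds,\ \pm\int\frac{\varphi}{\sqrt{(1+m^2)(1+\varphi^2)}}\,ds\right),$$ with $$R=\sqrt{\frac{1+m^2+m^2\varphi^2}{(1+m^2)(1+\varphi^2)}},\qquad \Theta=\frac{\sqrt{1+m^2}}{m}\arctan(\varphi)-\arctan\left(\frac{m\varphi}{\sqrt{1+m^2}}\right),$$ where $m$ is a constant with $m>0$ and $\varphi=\varphi(s)$ is a differentiable function such that $\varphi'(s)>0$ (respectively, $m<0$ and $\varphi'(s)<0$), and the two signs $\pm$ are equal (both $+$ or both $-$). That is, any slant helix that is not itself of this form differs from a curve of this form by a rigid motion.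
   Context: $\int f\,ds$ denotes an antiderivative of $f$ with respect to $s$. Curves are taken sufficiently smooth with curvature $\kappa>0$, so that the Frenet frame and the quotient $\tau/\kappa$ are defined; the torsion $\tau$ follows the convention $\mathbf{t}'=\kappa\mathbf{n}$, $\mathbf{n}'=-\kappa\mathbf{t}+\tau\mathbf{b}$, $\mathbf{b}'=-\tau\mathbf{n}$. A slant helix is a curve whose principal normal vector $\mathbf{n}$ makes a constant angle with a fixed direction; by a theorem of Izumiya and Takeuchi this is equivalent to the geodesic curvature in $S^2$ of the principal normal indicatrix $s\mapsto\mathbf{n}(s)$, $$\sigma=\frac{\kappa^2}{(\kappa^2+\tau^2)^{3/2}}\left(\frac{\tau}{\kappa}\right)',$$ being a constant function. A rigid motion is an orientation-preserving isometry of $\mathbb{R}^3$.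
   Formalization: Slant helices with constant τ/κ (σ = 0: circles, circular and other generalized helices) are excluded, since every curve of the displayed form has σ = m ≠ 0 and so the ''only if'' part fails for them. *)

(* Defs.v *)
From Stdlib Require Import Reals.
From Coquelicot Require Import Coquelicot.
Open Scope R_scope.

Notation E3 := (R * R * R)%type.

Definition px (v : E3) : R := fst (fst v).
Definition py (v : E3) : R := snd (fst v).
Definition pz (v : E3) : R := snd v.

Definition dot (u v : E3) : R := px u * px v + py u * py v + pz u * pz v.

Definition enorm (v : E3) : R := sqrt (dot v v).

Definition cross (u v : E3) : E3 :=
  (py u * pz v - pz u * py v,
   pz u * px v - px u * pz v,
   px u * py v - py u * px v).

Definition triple (u v w : E3) : R := dot (cross u v) w.

(* Endpoints in [Rbar], so that half-lines and the whole line are allowed. *)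
Definition in_open (a b : Rbar) (s : R) : Prop := Rbar_lt a s /\ Rbar_lt s b.

Definition ex_vderive (f : R -> E3) (s : R) : Prop :=
  ex_derive (fun u => px (f u)) s /\
  ex_derive (fun u => py (f u)) s /\
  ex_derive (fun u => pz (f u)) s.

Definition vDerive (f : R -> E3) (s : R) : E3 :=
  (Derive (fun u => px (f u)) s,
   Derive (fun u => py (f u)) s,
   Derive (fun u => pz (f u)) s).

(* These give the Frenet apparatus only for a unit-speed [alpha]. *)
Definition tangent (alpha : R -> E3) : R -> E3 := vDerive alpha.

Definition curvature (alpha : R -> E3) (s : R) : R :=
  enorm (vDerive (tangent alpha) s).

Definition normal (alpha : R -> E3) (s : R) : E3 :=
  scal (/ curvature alpha s) (vDerive (tangent alpha) s).

Definition binormal (alpha : R -> E3) (s : R) : E3 :=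
  cross (tangent alpha s) (normal alpha s).

(* The [b]-component of [n'], since [n' = - kappa t + tau b]. *)
Definition torsion (alpha : R -> E3) (s : R) : R :=
  dot (vDerive (normal alpha) s) (binormal alpha s).

(* The weakest regularity under which frame, curvature and torsion exist:
   [alpha], [alpha'] and the principal normal are differentiable. *)
Definition frenet_curve (a b : Rbar) (alpha : R -> E3) : Prop :=
  forall s, in_open a b s ->
    ex_vderive alpha s /\
    enorm (tangent alpha s) = 1 /\
    ex_vderive (tangent alpha) s /\
    0 < curvature alpha s /\
    ex_vderive (normal alpha) s.

Definition slant_helix (a b : Rbar) (alpha : R -> E3) : Prop :=
  frenet_curve a b alpha /\
  exists (d : E3) (theta : R),
    enorm d = 1 /\
    forall s, in_open a b s -> dot (normal alpha s) d = cos theta.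

(* Excludes the degenerate slant helices, those with [sigma = 0] (circles,
   circular helices and all other generalized helices). *)
Definition constant_tau_kappa (a b : Rbar) (alpha : R -> E3) : Prop :=
  exists c : R, forall s, in_open a b s ->
    torsion alpha s / curvature alpha s = c.

Definition isometry (f : E3 -> E3) : Prop :=
  forall p q : E3, enorm (minus (f p) (f q)) = enorm (minus p q).

Definition orientation_preserving (f : E3 -> E3) : Prop :=
  forall p u v w : E3, 0 < triple u v w ->
    0 < triple (minus (f (plus p u)) (f p))
               (minus (f (plus p v)) (f p))
               (minus (f (plus p w)) (f p)).

Definition rigid_motion (f : E3 -> E3) : Prop :=
  isometry f /\ orientation_preserving f.

Definition antiderivative_on (a b : Rbar) (F f : R -> R) : Prop :=
  forall s, in_open a b s -> is_derive F s (f s).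

Definition Rad (m x : R) : R :=
  sqrt ((1 + m ^ 2 + m ^ 2 * x ^ 2) / ((1 + m ^ 2) * (1 + x ^ 2))).

Definition Theta (m x : R) : R :=
  sqrt (1 + m ^ 2) / m * atan x - atan (m * x / sqrt (1 + m ^ 2)).

(* [eps] is the common value of the two signs; integration constants are
   arbitrary, as [X], [Y], [Z] range over all antiderivatives. *)
Definition slant_normal_form (a b : Rbar) (beta : R -> E3) : Prop :=
  exists (m eps : R) (phi X Y Z : R -> R),
    ((0 < m /\
      forall s, in_open a b s -> ex_derive phi s /\ 0 < Derive phi s) \/
     (m < 0 /\
      forall s, in_open a b s -> ex_derive phi s /\ Derive phi s < 0)) /\
    (eps = 1 \/ eps = -1) /\
    antiderivative_on a b X (fun s => Rad m (phi s) * cos (Theta m (phi s))) /\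
    antiderivative_on a b Y (fun s => Rad m (phi s) * sin (Theta m (phi s))) /\
    antiderivative_on a b Z
      (fun s => phi s / sqrt ((1 + m ^ 2) * (1 + phi s ^ 2))) /\
    forall s, in_open a b s -> beta s = (X s, eps * Y s, eps * Z s).

(* Main.v *)
Require Import Defs.
From Stdlib Require Import Reals Lra Ranalysis5.
From Coquelicot Require Import Coquelicot.
Open Scope R_scope.

(** A slant helix is determined up to congruence by its angle and one function.
    Let the unit vector [d] satisfy [n . d = k], and let [x] and [y] be the
    components of [t] and [b] along [d].  The Frenet equations give
    [x' = kappa k], [y' = - tau k] and, since [(n . d)' = 0],
    [kappa x = tau y]; moreover [x^2 + y^2 = 1 - k^2], and [y] cannot vanish
    ([slant_axis]).  Hence [tau / kappa = x / y], and this ratio is constant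
    exactly when [k = 0] ([constant_tau_kappa_iff]).

    For [k <> 0], orient [d] so that [y > 0] and put [phi = x / y] and
    [m = k / sqrt (1 - k^2)].  The equations above become
    [phi' = kappa m (1 + phi^2)^(3/2)] and [tau = kappa phi], so [phi] is
    strictly monotone with the sign of [m].  On the other hand, the unit vector
    [T(phi) = (R cos Theta, R sin Theta, phi / sqrt ((1 + m^2)(1 + phi^2)))]
    has derivative [N / (m (1 + phi^2)^(3/2))] in [phi], where [N] is a unit
    vector with constant third component [m / sqrt (1 + m^2)]
    ([is_vderive_slant_tangent], [slant_normal_unit]).  Composed with [phi(s)],
    the frame of [T] and [N] therefore solves the Frenet equations with the
    same [kappa] and [tau] as the given curve ([slant_frenet_system]).  Two
    solutions of the same Frenet equations differ by a constant rotation
    ([frenet_rotation_constant]), and the rotated curve is itself a curve with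
    tangent [T(phi)]: its coordinates are the required antiderivatives, so
    nothing has to be integrated.

    Conversely, an isometry of space is affine with orthonormal linear part
    ([isometry_affine]), and the common sign of the last two coordinates can be
    absorbed into that orthonormal basis.  The image of a curve in normal form
    then has principal normal [N(phi)] expressed in a fixed orthonormal basis,
    which makes the constant angle [arccos (m / sqrt (1 + m^2))] with the third
    basis vector; the cosine is nonzero, so [tau / kappa] is not constant. *)

(** * Vectors and orthonormal frames *)

Lemma vec_eq (u v : E3) : px u = px v -> py u = py v -> pz u = pz v -> u = v.
Proof.
  destruct u as [[? ?] ?], v as [[? ?] ?].
  unfold px, py, pz; cbn. congruence.
Qed.

Lemma px_plus (u v : E3) : px (plus u v) = px u + px v.
Proof. reflexivity. Qed.
Lemma py_plus (u v : E3) : py (plus u v) = py u + py v.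
Proof. reflexivity. Qed.
Lemma pz_plus (u v : E3) : pz (plus u v) = pz u + pz v.
Proof. reflexivity. Qed.
Lemma px_minus (u v : E3) : px (minus u v) = px u - px v.
Proof. reflexivity. Qed.
Lemma py_minus (u v : E3) : py (minus u v) = py u - py v.
Proof. reflexivity. Qed.
Lemma pz_minus (u v : E3) : pz (minus u v) = pz u - pz v.
Proof. reflexivity. Qed.
Lemma px_scal (k : R) (u : E3) : px (scal k u) = k * px u.
Proof. reflexivity. Qed.
Lemma py_scal (k : R) (u : E3) : py (scal k u) = k * py u.
Proof. reflexivity. Qed.
Lemma pz_scal (k : R) (u : E3) : pz (scal k u) = k * pz u.
Proof. reflexivity. Qed.
Lemma px_tuple (x y z : R) : px (x, y, z) = x.
Proof. reflexivity. Qed.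
Lemma py_tuple (x y z : R) : py (x, y, z) = y.
Proof. reflexivity. Qed.
Lemma pz_tuple (x y z : R) : pz (x, y, z) = z.
Proof. reflexivity. Qed.

#[local] Hint Rewrite px_plus py_plus pz_plus px_minus py_minus pz_minus
  px_scal py_scal pz_scal px_tuple py_tuple pz_tuple : coords.

Definition from_frame (e1 e2 e3 v : E3) : E3 :=
  plus (plus (scal (px v) e1) (scal (py v) e2)) (scal (pz v) e3).

Definition in_frame (e1 e2 e3 v : E3) : E3 := (dot e1 v, dot e2 v, dot e3 v).

Ltac coords :=
  unfold triple, in_frame, from_frame, dot, cross in *; autorewrite with coords.
Ltac by_coords := try apply vec_eq; coords; ring.

Lemma dot_comm (u v : E3) : dot u v = dot v u.
Proof. by_coords. Qed.

Lemma dot_plus_l (u v w : E3) : dot (plus u v) w = dot u w + dot v w.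
Proof. by_coords. Qed.

Lemma dot_scal_l (k : R) (u v : E3) : dot (scal k u) v = k * dot u v.
Proof. by_coords. Qed.

Lemma dot_scal_r (k : R) (u v : E3) : dot u (scal k v) = k * dot u v.
Proof. by_coords. Qed.

Lemma dot_from_frame_r (w e1 e2 e3 v : E3) :
  dot w (from_frame e1 e2 e3 v)
  = px v * dot w e1 + py v * dot w e2 + pz v * dot w e3.
Proof. by_coords. Qed.

Lemma dot_nonneg (u : E3) : 0 <= dot u u.
Proof. unfold dot. nra. Qed.

Lemma dot_self_eq_0 (u : E3) : dot u u = 0 -> px u = 0 /\ py u = 0 /\ pz u = 0.
Proof.
  unfold dot. intros H.
  repeat split; apply Rsqr_0_uniq; unfold Rsqr; nra.
Qed.

Lemma enorm_sq (u : E3) : enorm u * enorm u = dot u u.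
Proof. apply sqrt_sqrt, dot_nonneg. Qed.

Lemma enorm_eq_1 (u : E3) : enorm u = 1 <-> dot u u = 1.
Proof.
  unfold enorm. split; intros H.
  - rewrite <- (sqrt_sqrt (dot u u)) by apply dot_nonneg. rewrite H; ring.
  - rewrite H; apply sqrt_1.
Qed.

Definition orthonormal (e1 e2 e3 : E3) : Prop :=
  dot e1 e1 = 1 /\ dot e2 e2 = 1 /\ dot e3 e3 = 1 /\
  dot e1 e2 = 0 /\ dot e1 e3 = 0 /\ dot e2 e3 = 0.

Lemma orthonormal_cross (t n : E3) :
  dot t t = 1 -> dot n n = 1 -> dot t n = 0 -> orthonormal t n (cross t n).
Proof.
  intros Ht Hn Htn. repeat split; trivial; try by_coords.
  replace (dot (cross t n) (cross t n))
    with (dot t t * dot n n - dot t n * dot t n) by by_coords.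
  rewrite Ht, Hn, Htn; ring.
Qed.

Lemma triple_cross (t n : E3) :
  dot t t = 1 -> dot n n = 1 -> dot t n = 0 -> triple t n (cross t n) = 1.
Proof. intros Ht Hn Htn. now destruct (orthonormal_cross t n Ht Hn Htn) as (_ & _ & ? & _). Qed.

(** For arbitrary [t] and [n] the vector [|t x n|^2 v] is the combination of
    [t], [n] and [t x n] obtained from the dual basis of the Gram matrix;
    this is a polynomial identity. *)
Lemma from_frame_in_frame (t n v : E3) :
  dot t t = 1 -> dot n n = 1 -> dot t n = 0 ->
  from_frame t n (cross t n) (in_frame t n (cross t n) v) = v.
Proof.
  intros Ht Hn Htn.
  set (g := dot t t * dot n n - dot t n * dot t n).
  assert (E : scal g v
    = plus (plus (scal (dot t v) (minus (scal (dot n n) t) (scal (dot t n) n)))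
                 (scal (dot n v) (minus (scal (dot t t) n) (scal (dot t n) t))))
           (scal (dot (cross t n) v) (cross t n)))
    by (unfold g; by_coords).
  assert (Eg : g = 1) by (unfold g; rewrite Ht, Hn, Htn; ring).
  rewrite Eg, Ht, Hn, Htn in E. clear Eg g.
  pose proof (f_equal px E) as Ex. pose proof (f_equal py E) as Ey.
  pose proof (f_equal pz E) as Ez. clear E.
  unfold from_frame, in_frame.
  apply vec_eq; autorewrite with coords in *; lra.
Qed.

Lemma dot_from_frame (e1 e2 e3 u v : E3) :
  orthonormal e1 e2 e3 ->
  dot (from_frame e1 e2 e3 u) (from_frame e1 e2 e3 v) = dot u v.
Proof.
  intros (H1 & H2 & H3 & H12 & H13 & H23).
  replace (dot (from_frame e1 e2 e3 u) (from_frame e1 e2 e3 v)) with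
    (px u * px v * dot e1 e1 + py u * py v * dot e2 e2 + pz u * pz v * dot e3 e3
     + (px u * py v + py u * px v) * dot e1 e2
     + (px u * pz v + pz u * px v) * dot e1 e3
     + (py u * pz v + pz u * py v) * dot e2 e3) by by_coords.
  rewrite H1, H2, H3, H12, H13, H23. unfold dot; ring.
Qed.

Lemma in_frame_from_frame (e1 e2 e3 v : E3) :
  orthonormal e1 e2 e3 -> in_frame e1 e2 e3 (from_frame e1 e2 e3 v) = v.
Proof.
  intros (H1 & H2 & H3 & H12 & H13 & H23). unfold in_frame.
  rewrite !dot_from_frame_r, (dot_comm e2 e1), (dot_comm e3 e1), (dot_comm e3 e2).
  rewrite H1, H2, H3, H12, H13, H23.
  apply vec_eq; autorewrite with coords; ring.
Qed.

Lemma triple_from_frame (e1 e2 e3 u v w : E3) :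
  triple (from_frame e1 e2 e3 u) (from_frame e1 e2 e3 v) (from_frame e1 e2 e3 w)
  = triple e1 e2 e3 * triple u v w.
Proof. by_coords. Qed.

(** * Rigid motions *)

(** For orthonormal pairs, the rotation carrying [(T, N, T x N)] to
    [(t, n, t x n)]. *)
Definition frame_rotation (T N t n v : E3) : E3 :=
  from_frame t n (cross t n) (in_frame T N (cross T N) v).

Lemma frame_rotation_minus (T N t n u v : E3) :
  frame_rotation T N t n (minus u v)
  = minus (frame_rotation T N t n u) (frame_rotation T N t n v).
Proof.
  unfold frame_rotation. set (b := cross t n). set (B := cross T N). by_coords.
Qed.

Lemma frame_rotation_rigid (T N t n : E3) :
  dot T T = 1 -> dot N N = 1 -> dot T N = 0 ->
  dot t t = 1 -> dot n n = 1 -> dot t n = 0 ->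
  rigid_motion (frame_rotation T N t n).
Proof.
  intros HT HN HTN Ht Hn Htn. split.
  - intros p q. rewrite <- frame_rotation_minus.
    unfold enorm, frame_rotation. f_equal.
    rewrite dot_from_frame by now apply orthonormal_cross.
    set (v := minus p q).
    rewrite <- (dot_from_frame T N (cross T N)) by now apply orthonormal_cross.
    now rewrite from_frame_in_frame.
  - intros p u v w Huvw. rewrite <- !frame_rotation_minus.
    assert (E : forall x, minus (plus p x) p = x) by (intros; by_coords).
    rewrite !E. unfold frame_rotation.
    rewrite triple_from_frame, triple_cross by assumption.
    rewrite <- (from_frame_in_frame T N u), <- (from_frame_in_frame T N v),
      <- (from_frame_in_frame T N w), triple_from_frame, triple_cross in Huvw
      by assumption.
    lra.
Qed.

(** A distance-preserving map fixing the origin preserves inner products by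
    polarization, so it sends the standard basis to an orthonormal basis and
    [|g p - (p1 g e1 + p2 g e2 + p3 g e3)|^2] expands to zero. *)
Lemma isometry_affine (f : E3 -> E3) :
  isometry f ->
  exists e1 e2 e3 : E3, orthonormal e1 e2 e3 /\
    forall p, f p = plus (f (0, 0, 0)) (from_frame e1 e2 e3 p).
Proof.
  intros Hf.
  set (g := fun p => minus (f p) (f (0, 0, 0))).
  assert (Hd : forall p q, dot (minus (f p) (f q)) (minus (f p) (f q))
                           = dot (minus p q) (minus p q)).
  { intros p q. now rewrite <- !enorm_sq, Hf. }
  assert (Hg : forall p q, dot (g p) (g q) = dot p q).
  { intros p q.
    assert (Hp := Hd p (0, 0, 0)). assert (Hq := Hd q (0, 0, 0)).
    assert (Hpq := Hd p q). unfold g.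
    unfold dot in *. autorewrite with coords in *. nra. }
  set (e1 := g (1, 0, 0)). set (e2 := g (0, 1, 0)). set (e3 := g (0, 0, 1)).
  assert (Ho : orthonormal e1 e2 e3).
  { unfold orthonormal, e1, e2, e3. rewrite !Hg. repeat split; by_coords. }
  exists e1, e2, e3. split; [exact Ho|].
  intros p.
  assert (H0 : dot (minus (g p) (from_frame e1 e2 e3 p))
                   (minus (g p) (from_frame e1 e2 e3 p)) = 0).
  { replace (dot _ _) with
      (dot (g p) (g p) - 2 * dot (g p) (from_frame e1 e2 e3 p)
       + dot (from_frame e1 e2 e3 p) (from_frame e1 e2 e3 p)).
    2:{ generalize (from_frame e1 e2 e3 p). generalize (g p). intros; by_coords. }
    rewrite (dot_from_frame _ _ _ _ _ Ho), dot_from_frame_r.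
    unfold e1, e2, e3. rewrite !Hg. by_coords. }
  apply dot_self_eq_0 in H0. destruct H0 as (Hx & Hy & Hz).
  apply vec_eq; unfold g in *; autorewrite with coords in *; lra.
Qed.

(** * Derivatives of vector fields along an open interval *)

Definition is_vderive (f : R -> E3) (s : R) (l : E3) : Prop :=
  is_derive (fun u => px (f u)) s (px l) /\
  is_derive (fun u => py (f u)) s (py l) /\
  is_derive (fun u => pz (f u)) s (pz l).

Lemma is_vderive_ex (f : R -> E3) (s : R) (l : E3) :
  is_vderive f s l -> ex_vderive f s.
Proof. intros (? & ? & ?); split; [|split]; eexists; eassumption. Qed.

Lemma is_vderive_unique (f : R -> E3) (s : R) (l : E3) :
  is_vderive f s l -> vDerive f s = l.
Proof.
  intros (? & ? & ?). apply vec_eq; now apply is_derive_unique.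
Qed.

Lemma vDerive_correct (f : R -> E3) (s : R) :
  ex_vderive f s -> is_vderive f s (vDerive f s).
Proof. intros (? & ? & ?); split; [|split]; now apply Derive_correct. Qed.

Lemma locally_in_open (a b : Rbar) (P : R -> Prop) (s : R) :
  in_open a b s -> (forall u, in_open a b u -> P u) -> locally s P.
Proof.
  intros [H1 H2] H. apply (locally_interval P s a b H1 H2).
  intros y Ha Hb. apply H. now split.
Qed.

Lemma is_derive_ext_open (a b : Rbar) (f g : R -> R) (s l : R) :
  (forall u, in_open a b u -> f u = g u) -> in_open a b s ->
  is_derive f s l -> is_derive g s l.
Proof.
  intros E Hs. apply is_derive_ext_loc. now apply (locally_in_open a b).
Qed.

Lemma is_vderive_ext_open (a b : Rbar) (f g : R -> E3) (s : R) (l : E3) :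
  (forall u, in_open a b u -> f u = g u) -> in_open a b s ->
  is_vderive f s l -> is_vderive g s l.
Proof.
  intros E Hs (? & ? & ?); split; [|split];
    (eapply (is_derive_ext_open a b); [|exact Hs|eassumption]);
    intros u Hu; cbv beta; now rewrite E.
Qed.

Lemma is_derive_eq (f : R -> R) (s l l' : R) :
  is_derive f s l -> l = l' -> is_derive f s l'.
Proof. now intros ? <-. Qed.

Lemma is_derive_Rmult (f g : R -> R) (s f' g' : R) :
  is_derive f s f' -> is_derive g s g' ->
  is_derive (fun u => f u * g u) s (f' * g s + f s * g').
Proof. intros Hf Hg. exact (is_derive_mult f g s f' g' Hf Hg Rmult_comm). Qed.

Lemma is_derive_Rplus (f g : R -> R) (s f' g' : R) :
  is_derive f s f' -> is_derive g s g' ->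
  is_derive (fun u => f u + g u) s (f' + g').
Proof. exact (is_derive_plus f g s f' g'). Qed.

Lemma is_derive_Rminus (f g : R -> R) (s f' g' : R) :
  is_derive f s f' -> is_derive g s g' ->
  is_derive (fun u => f u - g u) s (f' - g').
Proof. exact (is_derive_minus f g s f' g'). Qed.

Lemma is_derive_Rconst (c s : R) : is_derive (fun _ => c) s 0.
Proof. exact (is_derive_const c s). Qed.

Lemma is_vderive_const (c : E3) (s : R) : is_vderive (fun _ => c) s (0, 0, 0).
Proof. split; [|split]; apply is_derive_Rconst. Qed.

Lemma is_derive_sum3_mult (f1 f2 f3 g1 g2 g3 : R -> R)
    (s f1' f2' f3' g1' g2' g3' : R) :
  is_derive f1 s f1' -> is_derive g1 s g1' ->
  is_derive f2 s f2' -> is_derive g2 s g2' ->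
  is_derive f3 s f3' -> is_derive g3 s g3' ->
  is_derive (fun u => f1 u * g1 u + f2 u * g2 u + f3 u * g3 u) s
    (f1' * g1 s + f1 s * g1' + (f2' * g2 s + f2 s * g2')
     + (f3' * g3 s + f3 s * g3')).
Proof.
  intros. apply is_derive_Rplus; [apply is_derive_Rplus|];
    apply is_derive_Rmult; assumption.
Qed.

Lemma is_derive_dot (f g : R -> E3) (s : R) (f' g' : E3) :
  is_vderive f s f' -> is_vderive g s g' ->
  is_derive (fun u => dot (f u) (g u)) s (dot f' (g s) + dot (f s) g').
Proof.
  intros (Fx & Fy & Fz) (Gx & Gy & Gz).
  eapply is_derive_eq;
    [exact (is_derive_sum3_mult _ _ _ _ _ _ _ _ _ _ _ _ _ Fx Gx Fy Gy Fz Gz)|].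
  unfold dot; ring.
Qed.

Lemma is_derive_dot_const (f : R -> E3) (s : R) (f' d : E3) :
  is_vderive f s f' -> is_derive (fun u => dot (f u) d) s (dot f' d).
Proof.
  intros Hf. eapply is_derive_eq.
  - exact (is_derive_dot f (fun _ => d) s _ _ Hf (is_vderive_const d s)).
  - by_coords.
Qed.

Lemma is_vderive_cross (f g : R -> E3) (s : R) (f' g' : E3) :
  is_vderive f s f' -> is_vderive g s g' ->
  is_vderive (fun u => cross (f u) (g u)) s
    (plus (cross f' (g s)) (cross (f s) g')).
Proof.
  intros (? & ? & ?) (? & ? & ?). unfold cross.
  split; [|split]; (eapply is_derive_eq;
    [apply is_derive_Rminus; apply is_derive_Rmult; eassumption|
     autorewrite with coords; cbv beta; ring]).
Qed.

Lemma is_vderive_tuple (f g h : R -> R) (s f' g' h' : R) :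
  is_derive f s f' -> is_derive g s g' -> is_derive h s h' ->
  is_vderive (fun u => (f u, g u, h u)) s (f', g', h').
Proof. split; [|split]; assumption. Qed.

Lemma is_vderive_from_frame (e1 e2 e3 v : R -> E3) (s : R) (e1' e2' e3' v' : E3) :
  is_vderive e1 s e1' -> is_vderive e2 s e2' -> is_vderive e3 s e3' ->
  is_vderive v s v' ->
  is_vderive (fun u => from_frame (e1 u) (e2 u) (e3 u) (v u)) s
    (plus (from_frame e1' e2' e3' (v s)) (from_frame (e1 s) (e2 s) (e3 s) v')).
Proof.
  intros (Ax & Ay & Az) (Bx & By & Bz) (Cx & Cy & Cz) (Vx & Vy & Vz).
  split; [|split]; eapply is_derive_eq.
  - exact (is_derive_sum3_mult _ _ _ _ _ _ _ _ _ _ _ _ _ Vx Ax Vy Bx Vz Cx).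
  - unfold from_frame; autorewrite with coords; ring.
  - exact (is_derive_sum3_mult _ _ _ _ _ _ _ _ _ _ _ _ _ Vx Ay Vy By Vz Cy).
  - unfold from_frame; autorewrite with coords; ring.
  - exact (is_derive_sum3_mult _ _ _ _ _ _ _ _ _ _ _ _ _ Vx Az Vy Bz Vz Cz).
  - unfold from_frame; autorewrite with coords; ring.
Qed.

Lemma is_vderive_from_const_frame (e1 e2 e3 : E3) (v : R -> E3) (s : R) (v' : E3) :
  is_vderive v s v' ->
  is_vderive (fun u => from_frame e1 e2 e3 (v u)) s (from_frame e1 e2 e3 v').
Proof.
  intros Hv.
  replace (from_frame e1 e2 e3 v') with
    (plus (from_frame (0, 0, 0) (0, 0, 0) (0, 0, 0) (v s)) (from_frame e1 e2 e3 v'))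
    by by_coords.
  apply (is_vderive_from_frame (fun _ => e1) (fun _ => e2) (fun _ => e3));
    trivial; apply is_vderive_const.
Qed.

Lemma is_vderive_comp (f : R -> E3) (phi : R -> R) (s phi' : R) (f' : E3) :
  is_vderive f (phi s) f' -> is_derive phi s phi' ->
  is_vderive (fun u => f (phi u)) s (scal phi' f').
Proof.
  intros (H1 & H2 & H3) Hphi. split; [|split].
  - exact (is_derive_comp (fun x => px (f x)) phi s _ _ H1 Hphi).
  - exact (is_derive_comp (fun x => py (f x)) phi s _ _ H2 Hphi).
  - exact (is_derive_comp (fun x => pz (f x)) phi s _ _ H3 Hphi).
Qed.

Lemma in_open_between (a b : Rbar) (s1 s2 s : R) :
  in_open a b s1 -> in_open a b s2 -> s1 <= s <= s2 -> in_open a b s.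
Proof.
  intros [H1 _] [_ H2] [Hl Hr]. split.
  - now apply (Rbar_lt_le_trans a s1 s).
  - now apply (Rbar_le_lt_trans s s2 b).
Qed.

Lemma in_open_nonempty (a b : Rbar) : Rbar_lt a b -> exists s, in_open a b s.
Proof.
  unfold in_open.
  destruct a as [a| |], b as [b| |]; cbn; try tauto; intros H.
  - exists ((a + b) / 2). lra.
  - exists (a + 1). lra.
  - exists (b - 1). lra.
  - exists 0. tauto.
Qed.

Lemma derive_0_constant (a b : Rbar) (f : R -> R) :
  (forall s, in_open a b s -> is_derive f s 0) ->
  forall s1 s2, in_open a b s1 -> in_open a b s2 -> f s1 = f s2.
Proof.
  intros Hf.
  assert (Hlt : forall s1 s2, in_open a b s1 -> in_open a b s2 -> s1 < s2 ->
                  f s1 = f s2).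
  { intros s1 s2 H1 H2 H12. apply eq_is_derive; trivial.
    intros s Hs. apply Hf. now apply (in_open_between a b s1 s2). }
  intros s1 s2 H1 H2. destruct (Rtotal_order s1 s2) as [H|[->|H]]; auto.
  symmetry; auto.
Qed.

Lemma constant_derive_0 (a b : Rbar) (f : R -> R) (c s l : R) :
  (forall u, in_open a b u -> f u = c) -> in_open a b s ->
  is_derive f s l -> l = 0.
Proof.
  intros Hc Hs Hf.
  assert (H0 : is_derive f s 0).
  { apply (is_derive_ext_open a b (fun _ => c)); auto using is_derive_Rconst.
    intros u Hu. now rewrite Hc. }
  apply is_derive_unique in Hf, H0. congruence.
Qed.

Lemma nonvanishing_constant_sign (a b : Rbar) (f : R -> R) (s0 : R) :
  (forall s, in_open a b s -> continuous f s /\ f s <> 0) ->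
  in_open a b s0 -> 0 < f s0 -> forall s, in_open a b s -> 0 < f s.
Proof.
  intros Hf Hs0 Hpos s Hs.
  destruct (Rtotal_order (f s) 0) as [Hneg|[H0|H]]; trivial.
  2:{ now apply Hf in Hs. }
  exfalso. destruct (Rtotal_order s s0) as [H|[->|H]]; [|lra|].
  - destruct (IVT_interv f s s0) as (z & Hz & Ez); trivial.
    { intros u Hu. apply continuity_pt_filterlim.
      apply Hf. now apply (in_open_between a b s s0). }
    apply (Hf z); trivial. now apply (in_open_between a b s s0).
  - destruct (IVT_interv (fun u => - f u) s0 s) as (z & Hz & Ez); try lra.
    { intros u Hu. apply continuity_pt_opp, continuity_pt_filterlim.
      apply Hf. now apply (in_open_between a b s0 s). }
    apply (Hf z); [now apply (in_open_between a b s0 s)|lra].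
Qed.

(** * Frenet systems *)

(** No curve is mentioned, so that the frame of the normal form can be compared
    with a given curve before any antiderivative of its tangent is known. *)
Definition frenet_system (a b : Rbar) (kappa tau : R -> R) (t n : R -> E3) : Prop :=
  forall s, in_open a b s ->
    dot (t s) (t s) = 1 /\ dot (n s) (n s) = 1 /\ dot (t s) (n s) = 0 /\
    is_vderive t s (scal (kappa s) (n s)) /\
    is_vderive n s
      (plus (scal (- kappa s) (t s)) (scal (tau s) (cross (t s) (n s)))).

Lemma frenet_binormal (a b : Rbar) (kappa tau : R -> R) (t n : R -> E3) :
  frenet_system a b kappa tau t n ->
  forall s, in_open a b s ->
    is_vderive (fun u => cross (t u) (n u)) s (scal (- tau s) (n s)).
Proof.
  intros HF s Hs. destruct (HF s Hs) as (Ht & Hn & Htn & Dt & Dn).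
  assert (D := is_vderive_cross _ _ _ _ _ Dt Dn).
  replace (scal (- tau s) (n s)) with
    (plus (scal (- tau s * dot (t s) (t s)) (n s))
          (scal (tau s * dot (t s) (n s)) (t s))).
  2:{ rewrite Ht, Htn. by_coords. }
  replace (plus _ _) with
    (plus (cross (scal (kappa s) (n s)) (n s))
       (cross (t s) (plus (scal (- kappa s) (t s))
                          (scal (tau s) (cross (t s) (n s)))))) by by_coords.
  exact D.
Qed.

(** For unit fields, the Frenet equations follow from [t' = kappa n] and the
    differentiability of [n]: differentiating [t . t], [t . n] and [n . n] leaves only the
    component of [n'] along [t x n] free, and that component is the torsion. *)
Lemma frenet_system_intro (a b : Rbar) (kappa : R -> R) (t n n' : R -> E3) :
  (forall s, in_open a b s ->
     dot (t s) (t s) = 1 /\ dot (n s) (n s) = 1 /\ kappa s <> 0 /\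
     is_vderive t s (scal (kappa s) (n s)) /\ is_vderive n s (n' s)) ->
  frenet_system a b kappa (fun s => dot (n' s) (cross (t s) (n s))) t n.
Proof.
  intros H.
  assert (Htn : forall s, in_open a b s -> dot (t s) (n s) = 0).
  { intros s Hs. destruct (H s Hs) as (_ & _ & Hk & Dt & _).
    assert (E := constant_derive_0 a b _ 1 s _ (fun u Hu => proj1 (H u Hu)) Hs
                   (is_derive_dot _ _ _ _ _ Dt Dt)).
    rewrite dot_scal_l, dot_scal_r, (dot_comm (n s)) in E.
    apply (Rmult_eq_reg_l (kappa s)); lra. }
  intros s Hs. destruct (H s Hs) as (Ht & Hn & Hk & Dt & Dn).
  repeat (split; [solve [auto]|]).
  assert (E1 := constant_derive_0 a b _ 0 s _ Htn Hs (is_derive_dot _ _ _ _ _ Dt Dn)).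
  assert (E2 := constant_derive_0 a b _ 1 s _ (fun u Hu => proj1 (proj2 (H u Hu))) Hs
                  (is_derive_dot _ _ _ _ _ Dn Dn)).
  rewrite dot_scal_l, Hn in E1. rewrite (dot_comm (n' s)) in E2.
  rewrite <- (from_frame_in_frame (t s) (n s) (n' s)) in Dn by auto.
  unfold in_frame in Dn.
  replace (dot (t s) (n' s)) with (- kappa s) in Dn by lra.
  replace (dot (n s) (n' s)) with 0 in Dn by lra.
  rewrite (dot_comm (cross _ _)) in Dn.
  replace (plus _ _) with (from_frame (t s) (n s) (cross (t s) (n s))
    (- kappa s, 0, dot (n' s) (cross (t s) (n s)))); [exact Dn|].
  generalize (dot (n' s) (cross (t s) (n s))). generalize (cross (t s) (n s)).
  intros. by_coords.
Qed.

(** The rotation between the two moving frames does not depend on [s]: in its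
    derivative the contributions of the two skew-symmetric Frenet matrices
    cancel. *)
Lemma frenet_rotation_constant (a b : Rbar) (kappa tau : R -> R)
    (t n T N : R -> E3) (s0 s : R) :
  frenet_system a b kappa tau t n -> frenet_system a b kappa tau T N ->
  in_open a b s0 -> in_open a b s ->
  frame_rotation (t s0) (n s0) (T s0) (N s0) (t s) = T s.
Proof.
  intros Hf HF Hs0 Hs.
  set (M := fun v u => frame_rotation (t u) (n u) (T u) (N u) v).
  assert (DM : forall v u, in_open a b u -> is_vderive (M v) u (0, 0, 0)).
  { intros v u Hu.
    destruct (Hf u Hu) as (_ & _ & _ & Dt & Dn).
    destruct (HF u Hu) as (_ & _ & _ & DT & DN).
    assert (Db := frenet_binormal _ _ _ _ _ _ Hf u Hu).
    assert (DB := frenet_binormal _ _ _ _ _ _ HF u Hu).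
    assert (Dc := is_vderive_tuple _ _ _ _ _ _ _
      (is_derive_dot_const _ _ _ v Dt) (is_derive_dot_const _ _ _ v Dn)
      (is_derive_dot_const _ _ _ v Db)).
    assert (D := is_vderive_from_frame _ _ _ _ _ _ _ _ _ DT DN DB Dc).
    unfold M, frame_rotation, in_frame.
    replace (0, 0, 0) with (plus
      (from_frame (scal (kappa u) (N u))
         (plus (scal (- kappa u) (T u)) (scal (tau u) (cross (T u) (N u))))
         (scal (- tau u) (N u))
         (dot (t u) v, dot (n u) v, dot (cross (t u) (n u)) v))
      (from_frame (T u) (N u) (cross (T u) (N u))
         (dot (scal (kappa u) (n u)) v,
          dot (plus (scal (- kappa u) (t u)) (scal (tau u) (cross (t u) (n u)))) v,
          dot (scal (- tau u) (n u)) v))); [exact D|].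
    rewrite dot_plus_l, !dot_scal_l.
    generalize (dot (t u) v) (dot (n u) v) (dot (cross (t u) (n u)) v).
    generalize (cross (T u) (N u)). intros. by_coords. }
  assert (EM : forall v, M v s0 = M v s).
  { intros v. apply vec_eq;
      [ apply (derive_0_constant a b (fun u => px (M v u)))
      | apply (derive_0_constant a b (fun u => py (M v u)))
      | apply (derive_0_constant a b (fun u => pz (M v u)))];
      trivial; intros u Hu; apply (DM v u Hu). }
  change (M (t s) s0 = T s). rewrite EM. unfold M, frame_rotation, in_frame.
  destruct (Hf s Hs) as (Ht & Hn & Htn & _).
  destruct (orthonormal_cross _ _ Ht Hn Htn) as (_ & _ & _ & _ & Htb & _).
  rewrite Ht, (dot_comm (n s)), Htn, (dot_comm _ (t s)), Htb. by_coords.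
Qed.

(** The second curve is the first one rotated by the inverse of [f]: its tangent
    is [T] because the rotation between the frames is constant. *)
Lemma frenet_system_congruence (a b : Rbar) (kappa tau : R -> R)
    (alpha t n T N : R -> E3) (s0 : R) :
  frenet_system a b kappa tau t n -> frenet_system a b kappa tau T N ->
  (forall s, in_open a b s -> is_vderive alpha s (t s)) -> in_open a b s0 ->
  exists (f : E3 -> E3) (beta : R -> E3),
    rigid_motion f /\ (forall s, in_open a b s -> is_vderive beta s (T s)) /\
    forall s, alpha s = f (beta s).
Proof.
  intros Hf HF Ha Hs0.
  destruct (Hf s0 Hs0) as (Ht & Hn & Htn & _).
  destruct (HF s0 Hs0) as (HT & HN & HTN & _).
  exists (frame_rotation (T s0) (N s0) (t s0) (n s0)),
    (fun s => frame_rotation (t s0) (n s0) (T s0) (N s0) (alpha s)).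
  split; [now apply frame_rotation_rigid|split].
  - intros s Hs.
    rewrite <- (frenet_rotation_constant a b kappa tau t n T N s0 s) by assumption.
    unfold frame_rotation. apply is_vderive_from_const_frame.
    assert (D := fun e => is_derive_dot_const alpha s (t s) e (Ha s Hs)).
    unfold in_frame. split; [|split]; cbn -[dot cross];
      rewrite (dot_comm _ (t s)); eapply is_derive_ext; try apply D;
      intros u; apply dot_comm.
  - intros s. unfold frame_rotation.
    rewrite in_frame_from_frame by now apply orthonormal_cross.
    now rewrite from_frame_in_frame.
Qed.

Lemma frenet_curve_system (a b : Rbar) (alpha : R -> E3) :
  frenet_curve a b alpha ->
  (forall s, in_open a b s ->
     is_vderive alpha s (tangent alpha s) /\ 0 < curvature alpha s) /\
  frenet_system a b (curvature alpha) (torsion alpha) (tangent alpha) (normal alpha).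
Proof.
  intros H. split.
  - intros s Hs. destruct (H s Hs) as (Da & _ & _ & Hk & _).
    split; trivial. now apply vDerive_correct.
  - apply frenet_system_intro. intros s Hs.
    destruct (H s Hs) as (_ & Ht & Dt & Hk & Dn).
    assert (Hk2 := enorm_sq (vDerive (tangent alpha) s)).
    fold (curvature alpha s) in Hk2.
    split; [now apply enorm_eq_1|]. split; [|split; [lra|split]].
    + unfold normal. rewrite dot_scal_l, dot_scal_r, <- Hk2. field; lra.
    + replace (scal _ _) with (vDerive (tangent alpha) s).
      * now apply vDerive_correct.
      * unfold normal. apply vec_eq; autorewrite with coords; field; lra.
    + now apply vDerive_correct.
Qed.

(** The converse of [frenet_curve_system]: any positive [kappa] and unit field
    [n] with [t' = kappa n] are the curvature and the principal normal, as a
    nonzero vector has only one decomposition into length and direction. *)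
Lemma frenet_curve_intro (a b : Rbar) (kappa : R -> R) (alpha t n : R -> E3) :
  (forall s, in_open a b s ->
     is_vderive alpha s (t s) /\ dot (t s) (t s) = 1 /\
     is_vderive t s (scal (kappa s) (n s)) /\ dot (n s) (n s) = 1 /\
     0 < kappa s /\ ex_vderive n s) ->
  frenet_curve a b alpha /\
  forall s, in_open a b s -> normal alpha s = n s.
Proof.
  intros H.
  assert (Et : forall s, in_open a b s -> tangent alpha s = t s).
  { intros s Hs. now apply is_vderive_unique, H. }
  assert (Dt : forall s, in_open a b s ->
                 is_vderive (tangent alpha) s (scal (kappa s) (n s))).
  { intros s Hs. apply (is_vderive_ext_open a b t); trivial.
    - intros u Hu. symmetry; auto.
    - now apply H. }
  assert (Ek : forall s, in_open a b s -> curvature alpha s = kappa s).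
  { intros s Hs. unfold curvature. rewrite (is_vderive_unique _ _ _ (Dt s Hs)).
    destruct (H s Hs) as (_ & _ & _ & Hn & Hk & _).
    unfold enorm. rewrite dot_scal_l, dot_scal_r, Hn, Rmult_1_r.
    apply sqrt_square; lra. }
  assert (En : forall s, in_open a b s -> normal alpha s = n s).
  { intros s Hs. unfold normal.
    rewrite (is_vderive_unique _ _ _ (Dt s Hs)), (Ek s Hs).
    destruct (H s Hs) as (_ & _ & _ & _ & Hk & _).
    apply vec_eq; autorewrite with coords; field; lra. }
  split; [|exact En].
  intros s Hs. destruct (H s Hs) as (Da & Ht & _ & _ & Hk & Dn).
  split; [now apply (is_vderive_ex _ _ _ Da)|].
  split; [rewrite Et by trivial; now apply enorm_eq_1|].
  split; [now apply (is_vderive_ex _ _ _ (Dt s Hs))|].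
  split; [now rewrite Ek|].
  apply vDerive_correct in Dn.
  apply (is_vderive_ex _ s (vDerive n s)), (is_vderive_ext_open a b n); trivial.
  intros u Hu. symmetry; auto.
Qed.

(** * The axis of a slant helix *)

(** The relations [kappa x = tau y] and [x^2 + y^2 = 1 - k^2] are the vanishing
    of [(n . d)'] and Parseval's identity for [d] in the Frenet frame. *)
Lemma slant_axis (a b : Rbar) (kappa tau : R -> R) (t n : R -> E3) (d : E3) (k : R) :
  frenet_system a b kappa tau t n ->
  (forall s, in_open a b s -> kappa s <> 0) ->
  dot d d = 1 -> (forall s, in_open a b s -> dot (n s) d = k) ->
  forall s, in_open a b s ->
    is_derive (fun u => dot (t u) d) s (kappa s * k) /\
    is_derive (fun u => dot (cross (t u) (n u)) d) s (- tau s * k) /\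
    kappa s * dot (t s) d = tau s * dot (cross (t s) (n s)) d /\
    (dot (t s) d) ^ 2 + (dot (cross (t s) (n s)) d) ^ 2 = 1 - k ^ 2 /\
    dot (cross (t s) (n s)) d <> 0.
Proof.
  intros HF Hk Hd Hnd.
  assert (Dx : forall s, in_open a b s ->
                 is_derive (fun u => dot (t u) d) s (kappa s * k)).
  { intros s Hs. destruct (HF s Hs) as (_ & _ & _ & Dt & _).
    rewrite <- (Hnd s Hs), <- dot_scal_l. now apply is_derive_dot_const. }
  assert (Exy : forall s, in_open a b s ->
                  kappa s * dot (t s) d = tau s * dot (cross (t s) (n s)) d).
  { intros s Hs. destruct (HF s Hs) as (_ & _ & _ & _ & Dn).
    assert (E := constant_derive_0 a b _ k s _ Hnd Hs
                   (is_derive_dot_const _ _ _ d Dn)).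
    rewrite dot_plus_l, !dot_scal_l in E. lra. }
  assert (Hsq : forall s, in_open a b s ->
    (dot (t s) d) ^ 2 + (dot (cross (t s) (n s)) d) ^ 2 = 1 - k ^ 2).
  { intros s Hs. destruct (HF s Hs) as (Ht & Hn & Htn & _).
    assert (E := dot_from_frame (t s) (n s) (cross (t s) (n s))
      (in_frame (t s) (n s) (cross (t s) (n s)) d)
      (in_frame (t s) (n s) (cross (t s) (n s)) d)
      (orthonormal_cross _ _ Ht Hn Htn)).
    rewrite from_frame_in_frame, Hd in E by assumption.
    unfold in_frame in E. rewrite (Hnd s Hs) in E.
    unfold dot at 1 in E. autorewrite with coords in E. lra. }
  intros s Hs.
  repeat (split; [solve [auto]|]).
  split.
  { rewrite <- (Hnd s Hs), <- dot_scal_l.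
    apply (is_derive_dot_const (fun u => cross (t u) (n u))).
    now apply (frenet_binormal a b kappa). }
  split; [auto|]. split; [auto|].
  intros Hy.
  (* If [y] vanishes then so do [x] and [1 - k^2], hence [x] vanishes
     identically, against [x' = kappa k] with [k = 1] or [k = -1]. *)
  assert (Hx : dot (t s) d = 0).
  { assert (E := Exy s Hs). rewrite Hy, Rmult_0_r in E.
    apply Rmult_integral in E. destruct E; trivial. now destruct (Hk s Hs). }
  assert (Hk1 : k ^ 2 = 1).
  { assert (E := Hsq s Hs). rewrite Hx, Hy in E. lra. }
  assert (Hx0 : forall u, in_open a b u -> dot (t u) d = 0).
  { intros u Hu. assert (E := Hsq u Hu). apply Rsqr_0_uniq; unfold Rsqr.
    nra. }
  assert (E := constant_derive_0 a b _ 0 s _ Hx0 Hs (Dx s Hs)).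
  apply Rmult_integral in E. destruct E as [E|E]; [now apply (Hk s Hs)|].
  rewrite E in Hk1. lra.
Qed.

(** With [x] and [y] the components of [t] and [b] along the axis,
    [tau / kappa = x / y]; for [k = 0] both are constant, while [x = c y]
    gives [kappa k = x' = c y' = - c tau k = - c^2 kappa k]. *)
Lemma constant_tau_kappa_iff (a b : Rbar) (alpha : R -> E3) (d : E3) (k s0 : R) :
  frenet_curve a b alpha -> in_open a b s0 ->
  dot d d = 1 -> (forall s, in_open a b s -> dot (normal alpha s) d = k) ->
  constant_tau_kappa a b alpha <-> k = 0.
Proof.
  intros Ha Hs0 Hd Hnd.
  destruct (frenet_curve_system a b alpha Ha) as (Hpos & HF).
  assert (Hk : forall s, in_open a b s -> curvature alpha s <> 0).
  { intros s Hs. destruct (Hpos s Hs); lra. }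
  assert (Hax := slant_axis a b _ _ _ _ d k HF Hk Hd Hnd).
  set (x := fun u => dot (tangent alpha u) d) in *.
  set (y := fun u => dot (cross (tangent alpha u) (normal alpha u)) d) in *.
  split.
  - intros [c Hc].
    destruct (Hax s0 Hs0) as (Dx & Dy & Exy & _ & _).
    assert (Hxy : forall u, in_open a b u -> x u - c * y u = 0).
    { intros u Hu. destruct (Hax u Hu) as (_ & _ & E & _ & _).
      change (curvature alpha u * x u = torsion alpha u * y u) in E.
      rewrite <- (Hc u Hu). apply (Rmult_eq_reg_l (curvature alpha u)); auto.
      field_simplify; auto. lra. }
    assert (E := constant_derive_0 a b _ 0 s0 _ Hxy Hs0
      (is_derive_Rminus _ _ _ _ _ Dx (is_derive_scal y s0 c _ Dy))).
    assert (Et : torsion alpha s0 = c * curvature alpha s0).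
    { rewrite <- (Hc s0 Hs0). field. auto. }
    rewrite Et in E.
    replace (curvature alpha s0 * k - c * (- (c * curvature alpha s0) * k))
      with (curvature alpha s0 * (1 + c ^ 2) * k) in E by ring.
    apply Rmult_integral in E. destruct E as [E|E]; trivial.
    apply Rmult_integral in E. destruct E as [E|E]; [now destruct (Hk s0 Hs0)|nra].
  - intros ->. exists (x s0 / y s0). intros s Hs.
    assert (Ex : x s = x s0).
    { apply (derive_0_constant a b); trivial. intros u Hu.
      destruct (Hax u Hu) as (D & _). now rewrite Rmult_0_r in D. }
    assert (Ey : y s = y s0).
    { apply (derive_0_constant a b); trivial. intros u Hu.
      destruct (Hax u Hu) as (_ & D & _). now rewrite Rmult_0_r in D. }
    rewrite <- Ex, <- Ey. destruct (Hax s Hs) as (_ & _ & E & _ & Hy).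
    change (curvature alpha s * x s = torsion alpha s * y s) in E.
    change (y s <> 0) in Hy.
    apply (Rmult_eq_reg_l (curvature alpha s * y s)).
    + field_simplify; auto. lra.
    + now apply Rmult_integral_contrapositive_currified; auto.
Qed.

(** * The normal form as a moving frame *)

Definition slant_tangent (m x : R) : E3 :=
  (Rad m x * cos (Theta m x), Rad m x * sin (Theta m x),
   x / sqrt ((1 + m ^ 2) * (1 + x ^ 2))).

(** The derivative of [slant_tangent m] times [m (1 + x^2)^(3/2)], a factor
    whose sign is that of [m]; here
    [p = sqrt ((1 + m^2)(1 + x^2)) R = sqrt (1 + m^2 + m^2 x^2)]. *)
Definition slant_normal (m x : R) : E3 :=
  let c := sqrt (1 + m ^ 2) in
  let p := sqrt ((1 + m ^ 2) * (1 + x ^ 2)) * Rad m x in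
  (- (m * x / c / p) * cos (Theta m x) - / p * sin (Theta m x),
   - (m * x / c / p) * sin (Theta m x) + / p * cos (Theta m x),
   m / c).

Lemma sqrt_pos_sq (x : R) : 0 < x -> 0 < sqrt x /\ sqrt x ^ 2 = x.
Proof.
  intros H. split; [now apply sqrt_lt_R0|]. apply pow2_sqrt; lra.
Qed.

Lemma Rad_pos_sq (m x : R) :
  0 < Rad m x /\
  (1 + m ^ 2) * (1 + x ^ 2) * Rad m x ^ 2 = 1 + m ^ 2 + m ^ 2 * x ^ 2.
Proof.
  assert (Hm := pow2_ge_0 m). assert (Hx := pow2_ge_0 x).
  destruct (sqrt_pos_sq ((1 + m ^ 2 + m ^ 2 * x ^ 2) / ((1 + m ^ 2) * (1 + x ^ 2))))
    as [HR ER].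
  { apply Rdiv_lt_0_compat; nra. }
  split; [exact HR|]. unfold Rad. rewrite ER. field. split; nra.
Qed.

Lemma slant_tangent_unit (m x : R) :
  dot (slant_tangent m x) (slant_tangent m x) = 1.
Proof.
  destruct (Rad_pos_sq m x) as [_ ER].
  destruct (sqrt_pos_sq ((1 + m ^ 2) * (1 + x ^ 2))) as [HP EP]; [nra|].
  unfold slant_tangent, dot. autorewrite with coords.
  set (P := sqrt ((1 + m ^ 2) * (1 + x ^ 2))) in *. assert (SC := sin2_cos2 (Theta m x)). unfold Rsqr in SC.
  set (C := cos _) in *. set (S := sin _) in *. set (r := Rad m x) in *.
  replace (r * C * (r * C) + r * S * (r * S) + x / P * (x / P))
    with ((P ^ 2 * r ^ 2 * (S * S + C * C) + x ^ 2) / P ^ 2) by (field; lra).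
  rewrite SC, EP, Rmult_1_r, ER. field. split; nra.
Qed.

Lemma slant_normal_unit (m x : R) :
  dot (slant_normal m x) (slant_normal m x) = 1.
Proof.
  destruct (Rad_pos_sq m x) as [HR ER].
  destruct (sqrt_pos_sq (1 + m ^ 2)) as [Hc Ec]; [nra|].
  destruct (sqrt_pos_sq ((1 + m ^ 2) * (1 + x ^ 2))) as [HP EP]; [nra|].
  unfold slant_normal, dot. cbv zeta. autorewrite with coords.
  assert (SC := sin2_cos2 (Theta m x)). unfold Rsqr in SC.
  set (c := sqrt (1 + m ^ 2)) in *. set (P := sqrt ((1 + m ^ 2) * (1 + x ^ 2))) in *.
  set (C := cos _) in *. set (S := sin _) in *. set (r := Rad m x) in *.
  set (u := m * x / c / (P * r)). set (v := / (P * r)).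
  replace ((- u * C - v * S) * (- u * C - v * S)
    + (- u * S + v * C) * (- u * S + v * C) + m / c * (m / c))
    with ((u ^ 2 + v ^ 2) * (S * S + C * C) + m ^ 2 / c ^ 2) by (field; lra).
  rewrite SC.
  replace (u ^ 2 + v ^ 2) with ((m ^ 2 * x ^ 2 + c ^ 2) / (c ^ 2 * (P ^ 2 * r ^ 2)))
    by (unfold u, v; field; lra).
  rewrite EP, ER, Ec. field. split; nra.
Qed.

(** Together with the third component of [slant_tangent], this makes [x] the
    ratio of the components of tangent and binormal along the third axis. *)
Lemma slant_binormal_z (m x : R) :
  pz (cross (slant_tangent m x) (slant_normal m x))
  = / sqrt ((1 + m ^ 2) * (1 + x ^ 2)).
Proof.
  destruct (Rad_pos_sq m x) as [HR _].
  destruct (sqrt_pos_sq ((1 + m ^ 2) * (1 + x ^ 2))) as [HP _]; [nra|].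
  destruct (sqrt_pos_sq (1 + m ^ 2)) as [Hc _]; [nra|].
  unfold slant_tangent, slant_normal, cross. cbv zeta. autorewrite with coords.
  assert (SC := sin2_cos2 (Theta m x)). unfold Rsqr in SC.
  set (c := sqrt (1 + m ^ 2)) in *.
  set (P := sqrt ((1 + m ^ 2) * (1 + x ^ 2))) in *. set (C := cos _) in *. set (S := sin _) in *.
  set (r := Rad m x) in *.
  transitivity ((S * S + C * C) / P); [field; lra|]. rewrite SC. field; lra.
Qed.

Lemma is_derive_Rad (m x : R) :
  is_derive (Rad m) x (- x / ((1 + m ^ 2) * (1 + x ^ 2) ^ 2 * Rad m x)).
Proof.
  destruct (Rad_pos_sq m x) as [HR _].
  unfold Rad in *. auto_derive.
  - assert (Hm := pow2_ge_0 m). assert (Hx := pow2_ge_0 x).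
    split; [nra|]. split; trivial. apply Rdiv_lt_0_compat; nra.
  - unfold Rdiv in *. set (r := sqrt _) in *. 
    field. repeat split; nra.
Qed.

(** The two arctangents combine because [(1 + m^2) - m^2 = 1]. *)
Lemma is_derive_Theta (m x : R) : m <> 0 ->
  is_derive (Theta m) x
    (/ (m * sqrt (1 + m ^ 2) * (1 + x ^ 2) ^ 2 * Rad m x ^ 2)).
Proof.
  intros Hm.
  destruct (Rad_pos_sq m x) as [HR ER].
  destruct (sqrt_pos_sq (1 + m ^ 2)) as [Hc Ec]; [nra|].
  assert (ER' : Rad m x ^ 2
    = (1 + m ^ 2 + m ^ 2 * x ^ 2) / ((1 + m ^ 2) * (1 + x ^ 2))).
  { rewrite <- ER. field. split; nra. }
  rewrite ER'. unfold Theta. auto_derive; [trivial|].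
  change (m * (m * 1)) with (m ^ 2).
  set (c := sqrt (1 + m ^ 2)) in *. rewrite <- !Ec.
  set (r := / (m * c * (1 + x ^ 2) ^ 2 *
            ((c ^ 2 + m ^ 2 * x ^ 2) / (c ^ 2 * (1 + x ^ 2))))).
  (* Multiplying by [c^2 - m^2 = 1] turns the claim into an identity of rational
     functions in which [c] and [m] are independent. *)
  transitivity ((c ^ 2 - m ^ 2) * r).
  - unfold r. field. repeat split; nra.
  - replace (c ^ 2 - m ^ 2) with 1 by lra. ring.
Qed.

Lemma is_vderive_slant_tangent (m x : R) : m <> 0 ->
  is_vderive (slant_tangent m) x
    (scal (/ (m * sqrt (1 + x ^ 2) ^ 3)) (slant_normal m x)).
Proof.
  intros Hm.
  destruct (Rad_pos_sq m x) as [HR _].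
  destruct (sqrt_pos_sq (1 + m ^ 2)) as [Hc Ec]; [nra|].
  destruct (sqrt_pos_sq (1 + x ^ 2)) as [Hw Ew]; [nra|].
  assert (EP : sqrt ((1 + m ^ 2) * (1 + x ^ 2)) = sqrt (1 + m ^ 2) * sqrt (1 + x ^ 2))
    by (apply sqrt_mult; nra).
  assert (DR := is_derive_Rad m x). assert (DT := is_derive_Theta m x Hm).
  assert (DC := is_derive_comp cos (Theta m) x _ _ (is_derive_cos _) DT).
  assert (DS := is_derive_comp sin (Theta m) x _ _ (is_derive_sin _) DT).
  unfold slant_tangent, slant_normal. cbv zeta.
  split; [|split]; autorewrite with coords; eapply is_derive_eq.
  - exact (is_derive_Rmult _ _ _ _ _ DR DC).
  - change scal with Rmult. cbv beta. rewrite EP.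
    set (c := sqrt (1 + m ^ 2)) in *. set (w := sqrt (1 + x ^ 2)) in *.
    rewrite <- !Ec, <- !Ew. field. lra.
  - exact (is_derive_Rmult _ _ _ _ _ DR DS).
  - change scal with Rmult. cbv beta. rewrite EP.
    set (c := sqrt (1 + m ^ 2)) in *. set (w := sqrt (1 + x ^ 2)) in *.
    rewrite <- !Ec, <- !Ew. field. lra.
  - apply (is_derive_div (fun x => x) (fun x => sqrt ((1 + m ^ 2) * (1 + x ^ 2)))).
    + apply (is_derive_id (K := R_AbsRing)).
    + apply (is_derive_sqrt (fun x => (1 + m ^ 2) * (1 + x ^ 2)) x
        ((1 + m ^ 2) * (2 * x))); [auto_derive; trivial; ring|nra].
    + rewrite EP. nra.
  - cbv beta. rewrite EP. change one with 1.
    set (c := sqrt (1 + m ^ 2)) in *. set (w := sqrt (1 + x ^ 2)) in *.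
    rewrite <- Ec. transitivity ((w ^ 2 - x ^ 2) / (c * w ^ 3)).
    + field. lra.
    + rewrite Ew. field. lra.
Qed.

Lemma ex_vderive_slant_normal (m x : R) : m <> 0 -> ex_vderive (slant_normal m) x.
Proof.
  intros Hm.
  destruct (Rad_pos_sq m x) as [HR _].
  destruct (sqrt_pos_sq (1 + m ^ 2)) as [Hc _]; [nra|].
  assert (HP1 : 0 < (1 + m ^ 2) * (1 + x ^ 2)) by nra.
  destruct (sqrt_pos_sq _ HP1) as [HP _].
  assert (DT := is_derive_Theta m x Hm).
  assert (DC : ex_derive (fun u => cos (Theta m u)) x)
    by (eexists; exact (is_derive_comp cos (Theta m) x _ _ (is_derive_cos _) DT)).
  assert (DS : ex_derive (fun u => sin (Theta m u)) x)
    by (eexists; exact (is_derive_comp sin (Theta m) x _ _ (is_derive_sin _) DT)).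
  assert (Dp : ex_derive
    (fun u => sqrt ((1 + m ^ 2) * (1 + u ^ 2)) * Rad m u) x).
  { eexists. apply is_derive_Rmult; [|apply is_derive_Rad].
    apply (is_derive_sqrt (fun u => (1 + m ^ 2) * (1 + u ^ 2)) x
      ((1 + m ^ 2) * (2 * x))); [auto_derive; trivial; ring|exact HP1]. }
  assert (Hp := Rmult_lt_0_compat _ _ HP HR).
  assert (Hgen : forall (c : R) (p C S : R -> R), 0 < c -> 0 < p x ->
    ex_derive p x -> ex_derive C x -> ex_derive S x ->
    ex_vderive (fun u => (- (m * u / c / p u) * C u - / p u * S u,
                          - (m * u / c / p u) * S u + / p u * C u, m / c)) x).
  { intros c p C S Hc' Hp' ? ? ?.
    assert (p x <> 0) by lra.
    split; [|split]; unfold px, py, pz; cbn; auto_derive; repeat split; trivial. }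
  exact (Hgen _ _ _ _ Hc Hp Dp DC DS).
Qed.

Lemma is_vderive_slant_frame (m kappa s : R) (phi : R -> R) :
  m <> 0 -> is_derive phi s (kappa * (m * sqrt (1 + phi s ^ 2) ^ 3)) ->
  is_vderive (fun u => slant_tangent m (phi u)) s
    (scal kappa (slant_normal m (phi s))) /\
  ex_vderive (fun u => slant_normal m (phi u)) s.
Proof.
  intros Hm Dphi. split.
  - assert (D := is_vderive_comp _ _ _ _ _
      (is_vderive_slant_tangent m (phi s) Hm) Dphi).
    destruct (sqrt_pos_sq (1 + phi s ^ 2)) as [Hw _]; [nra|].
    match type of D with is_vderive _ _ ?l =>
      replace (scal kappa (slant_normal m (phi s))) with l end; [exact D|].
    apply vec_eq; autorewrite with coords; field; lra.
  - exact (is_vderive_ex _ _ _ (is_vderive_comp _ _ _ _ _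
      (vDerive_correct _ _ (ex_vderive_slant_normal m (phi s) Hm)) Dphi)).
Qed.

(** Only [t' = kappa n] has to be computed: the third component of [n] is
    constant, so [tau] is determined by the ratio of the third components of
    [t] and [b], which is [phi]. *)
Lemma slant_frenet_system (a b : Rbar) (m : R) (kappa phi : R -> R) :
  m <> 0 ->
  (forall s, in_open a b s -> kappa s <> 0 /\
     is_derive phi s (kappa s * (m * sqrt (1 + phi s ^ 2) ^ 3))) ->
  frenet_system a b kappa (fun s => kappa s * phi s)
    (fun s => slant_tangent m (phi s)) (fun s => slant_normal m (phi s)).
Proof.
  intros Hm H.
  assert (HF := frenet_system_intro a b kappa
    (fun s => slant_tangent m (phi s)) (fun s => slant_normal m (phi s))
    (vDerive (fun s => slant_normal m (phi s)))).
  match type of HF with ?P -> _ => assert (Hyp : P) end.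
  { intros s Hs. destruct (H s Hs) as (Hk & Dphi).
    destruct (is_vderive_slant_frame m (kappa s) s phi Hm Dphi) as (Dt & Dn).
    repeat (split; [solve [trivial | apply slant_tangent_unit | apply slant_normal_unit]|]).
    now apply vDerive_correct. }
  specialize (HF Hyp). clear Hyp.
  assert (Hax := slant_axis a b _ _ _ _ (0, 0, 1) (m / sqrt (1 + m ^ 2)) HF
    (fun s Hs => proj1 (H s Hs)) ltac:(by_coords)
    ltac:(intros; unfold slant_normal, dot; cbv zeta; autorewrite with coords; ring)).
  intros s Hs. destruct (HF s Hs) as (Ht & Hn & Htn & Dt & Dn).
  repeat (split; [assumption|]).
  destruct (Hax s Hs) as (_ & _ & E & _ & _).
  set (tau := dot (vDerive _ _) _) in *.
  assert (Epz : forall v, dot v (0, 0, 1) = pz v) by (intros; by_coords).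
  rewrite !Epz, slant_binormal_z in E. unfold slant_tangent at 1 in E.
  rewrite pz_tuple in E.
  destruct (sqrt_pos_sq ((1 + m ^ 2) * (1 + phi s ^ 2))) as [HP _]; [nra|].
  replace (kappa s * phi s) with tau; [exact Dn|].
  apply (f_equal (Rmult (sqrt ((1 + m ^ 2) * (1 + phi s ^ 2))))) in E.
  field_simplify in E; lra.
Qed.

(** * The two implications *)

(** The binormal of the normal form has a positive component along the third
    axis, so an axis of a given slant helix must be oriented to match; the
    component never vanishes and hence has a constant sign. *)
Lemma slant_helix_positive_axis (a b : Rbar) (kappa tau : R -> R)
    (t n : R -> E3) (d : E3) (k s0 : R) :
  frenet_system a b kappa tau t n ->
  (forall s, in_open a b s -> kappa s <> 0) -> in_open a b s0 ->
  dot d d = 1 -> (forall s, in_open a b s -> dot (n s) d = k) -> k <> 0 ->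
  exists (d' : E3) (k' : R), dot d' d' = 1 /\ k' <> 0 /\
    forall s, in_open a b s ->
      dot (n s) d' = k' /\ 0 < dot (cross (t s) (n s)) d'.
Proof.
  intros HF Hk Hs0 Hd Hnd Hk0.
  assert (Hax := slant_axis a b _ _ _ _ d k HF Hk Hd Hnd).
  set (y := fun u => dot (cross (t u) (n u)) d) in *.
  assert (Hy : forall s, in_open a b s -> continuous y s /\ y s <> 0).
  { intros s Hs. destruct (Hax s Hs) as (_ & Dy & _ & _ & Hy). split; trivial.
    apply (ex_derive_continuous (K := R_AbsRing) (V := R_NormedModule)).
    now exists (- tau s * k). }
  destruct (Hy s0 Hs0) as [_ Hy0].
  destruct (Rdichotomy _ _ Hy0) as [Hneg|Hpos].
  - exists (scal (-1) d), (- k). rewrite dot_scal_l, dot_scal_r, Hd.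
    split; [ring|split; [lra|]]. intros s Hs. rewrite !dot_scal_r, Hnd by trivial.
    split; [ring|].
    assert (H : 0 < - y s); [|unfold y in H; lra].
    apply (nonvanishing_constant_sign a b (fun u => - y u) s0); trivial; [|lra].
    intros u Hu. destruct (Hy u Hu) as [Cy Ny]. split; [|lra].
    now apply (continuous_opp y).
  - exists d, k. repeat split; trivial; [now apply Hnd|].
    now apply (nonvanishing_constant_sign a b y s0).
Qed.

Lemma slant_helix_normal_form (a b : Rbar) (alpha : R -> E3) :
  Rbar_lt a b -> slant_helix a b alpha -> ~ constant_tau_kappa a b alpha ->
  exists (f : E3 -> E3) (beta : R -> E3),
    rigid_motion f /\ slant_normal_form a b beta /\
    forall s, in_open a b s -> alpha s = f (beta s).
Proof.
  intros hab [Ha (d0 & theta & Hd0 & Hn0)] Hnc.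
  destruct (in_open_nonempty a b hab) as [s0 Hs0].
  apply enorm_eq_1 in Hd0.
  assert (Hk0 : cos theta <> 0).
  { intros E. apply Hnc.
    now apply (constant_tau_kappa_iff a b alpha d0 (cos theta) s0). }
  destruct (frenet_curve_system a b alpha Ha) as (Hpos & HF).
  assert (Hk : forall s, in_open a b s -> curvature alpha s <> 0).
  { intros s Hs. destruct (Hpos s Hs); lra. }
  destruct (slant_helix_positive_axis a b _ _ _ _ d0 _ s0 HF Hk Hs0 Hd0 Hn0 Hk0)
    as (d & k & Hd & Hkn & Hdy).
  assert (Hax := slant_axis a b _ _ _ _ d k HF Hk Hd (fun s Hs => proj1 (Hdy s Hs))).
  set (kappa := curvature alpha) in *. set (tau := torsion alpha) in *.
  set (t := tangent alpha) in *. set (n := normal alpha) in *.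
  set (x := fun u => dot (t u) d) in *.
  set (y := fun u => dot (cross (t u) (n u)) d) in *.
  assert (Hxy : forall s, in_open a b s ->
    is_derive x s (kappa s * k) /\ is_derive y s (- tau s * k) /\
    kappa s * x s = tau s * y s /\ x s ^ 2 + y s ^ 2 = 1 - k ^ 2 /\ 0 < y s).
  { intros s Hs. destruct (Hax s Hs) as (? & ? & ? & ? & _).
    destruct (Hdy s Hs). now repeat (split; [assumption|]). }
  clearbody x y. clear Hax Hdy.
  assert (Hk1 : 0 < 1 - k ^ 2).
  { destruct (Hxy s0 Hs0) as (_ & _ & _ & E & ?). nra. }
  destruct (sqrt_pos_sq _ Hk1) as [Hh Eh].
  set (h := sqrt (1 - k ^ 2)) in *.
  set (m := k / h). set (phi := fun u => x u / y u).
  assert (Hm : m <> 0).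
  { unfold m, Rdiv. apply Rmult_integral_contrapositive_currified; trivial.
    apply Rinv_neq_0_compat; lra. }
  assert (Dphi : forall s, in_open a b s ->
    is_derive phi s (kappa s * (m * sqrt (1 + phi s ^ 2) ^ 3))).
  { intros s Hs. destruct (Hxy s Hs) as (Dx & Dy & Exy & Esq & Hy).
    assert (Ew : sqrt (1 + phi s ^ 2) = h / y s).
    { apply sqrt_lem_1.
      - nra.
      - apply Rlt_le, Rdiv_lt_0_compat; lra.
      - unfold phi. replace (h / y s * (h / y s)) with (h ^ 2 / y s ^ 2) by (field; lra).
        rewrite Eh, <- Esq. field; lra. }
    rewrite Ew. eapply is_derive_eq.
    - apply (is_derive_div x y); try eassumption; lra.
    - assert (Et : tau s = kappa s * x s / y s).
      { apply (Rmult_eq_reg_r (y s)); [|lra]. rewrite <- Exy. field; lra. }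
      rewrite Et. unfold m.
      transitivity (kappa s * k * (x s ^ 2 + y s ^ 2) / y s ^ 3); [field; lra|].
      rewrite Esq, <- Eh. field; lra. }
  assert (HF' : frenet_system a b kappa tau
    (fun s => slant_tangent m (phi s)) (fun s => slant_normal m (phi s))).
  { assert (HM := slant_frenet_system a b m kappa phi Hm
      (fun s Hs => conj (Hk s Hs) (Dphi s Hs))).
    intros s Hs. destruct (Hxy s Hs) as (_ & _ & Exy & _ & Hy).
    replace (tau s) with (kappa s * phi s); [now apply HM|].
    unfold phi. apply (Rmult_eq_reg_r (y s)); [|lra]. rewrite <- Exy. field; lra. }
  destruct (frenet_system_congruence a b kappa tau alpha t n _ _ s0 HF HF'
    (fun s Hs => proj1 (Hpos s Hs)) Hs0) as (f & beta & Hf & Hbeta & Ef).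
  exists f, beta. split; [exact Hf|split; [|auto]].
  exists m, 1, phi, (fun u => px (beta u)), (fun u => py (beta u)),
    (fun u => pz (beta u)).
  split; [|split; [now left|split; [|split; [|split]]]].
  - assert (Hphi : forall s, in_open a b s -> ex_derive phi s /\
      exists p, 0 < p /\ Derive phi s = m * p).
    { intros s Hs. split; [eexists; now apply Dphi|].
      exists (kappa s * sqrt (1 + phi s ^ 2) ^ 3). split.
      - apply Rmult_lt_0_compat; [now apply Hpos|].
        apply pow_lt, sqrt_lt_R0. nra.
      - rewrite (is_derive_unique _ _ _ (Dphi s Hs)). ring. }
    destruct (Rdichotomy _ _ Hm) as [Hneg|Hp]; [right|left];
      (split; [trivial|]); intros s Hs;
      destruct (Hphi s Hs) as (De & p & Hp' & ->); split; trivial; nra.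
  - intros s Hs. apply (Hbeta s Hs).
  - intros s Hs. apply (Hbeta s Hs).
  - intros s Hs. apply (Hbeta s Hs).
  - intros s Hs. apply vec_eq; autorewrite with coords; ring.
Qed.

(** The sign [eps] is moved from the coordinates of the normal form into the
    orthonormal basis of the affine form of [f]. *)
Lemma normal_form_slant_helix (a b : Rbar) (alpha beta : R -> E3) (f : E3 -> E3) :
  Rbar_lt a b -> isometry f -> slant_normal_form a b beta ->
  (forall s, in_open a b s -> alpha s = f (beta s)) ->
  slant_helix a b alpha /\ ~ constant_tau_kappa a b alpha.
Proof.
  intros hab Hf (m & eps & phi & X & Y & Z & Hphi & Heps & DX & DY & DZ & Eb) Ea.
  destruct (in_open_nonempty a b hab) as [s0 Hs0].
  destruct (isometry_affine f Hf) as (e1 & e2 & e3 & He & Ef).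
  set (A := from_frame e1 (scal eps e2) (scal eps e3)).
  assert (HA : orthonormal e1 (scal eps e2) (scal eps e3)).
  { destruct He as (H1 & H2 & H3 & H12 & H13 & H23). unfold orthonormal.
    rewrite !dot_scal_l, !dot_scal_r, H1, H2, H3, H12, H13, H23.
    destruct Heps as [-> | ->]; repeat split; ring. }
  assert (Hm : m <> 0) by (destruct Hphi as [[? _]|[? _]]; lra).
  destruct (sqrt_pos_sq (1 + m ^ 2)) as [Hc Ec]; [nra|].
  set (c := sqrt (1 + m ^ 2)) in *.
  set (kappa := fun s => Derive phi s / (m * sqrt (1 + phi s ^ 2) ^ 3)).
  assert (Hw : forall s, 0 < sqrt (1 + phi s ^ 2) ^ 3).
  { intros s. apply pow_lt, sqrt_lt_R0. nra. }
  assert (Hkappa : forall s, in_open a b s -> 0 < kappa s /\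
    is_derive phi s (kappa s * (m * sqrt (1 + phi s ^ 2) ^ 3))).
  { intros s Hs. assert (Hws := Hw s). unfold kappa.
    set (q := sqrt (1 + phi s ^ 2) ^ 3) in *. split.
    - destruct Hphi as [[Hm' H]|[Hm' H]]; destruct (H s Hs) as [_ Hd].
      + apply Rdiv_lt_0_compat; trivial. now apply Rmult_lt_0_compat.
      + replace (Derive phi s / (m * q)) with (- Derive phi s / (- m * q))
          by (field; lra).
        apply Rdiv_lt_0_compat; [lra|]. apply Rmult_lt_0_compat; lra.
    - replace (Derive phi s / (m * q) * (m * q)) with (Derive phi s)
        by (field; lra).
      apply Derive_correct. destruct Hphi as [[_ H]|[_ H]]; now apply H. }
  destruct (frenet_curve_intro a b kappa alpha
    (fun s => A (slant_tangent m (phi s))) (fun s => A (slant_normal m (phi s))))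
    as (Ha & En).
  { intros s Hs. destruct (Hkappa s Hs) as (Hk & Dphi).
    destruct (is_vderive_slant_frame m (kappa s) s phi Hm Dphi) as (Dt & Dn).
    unfold A. rewrite !dot_from_frame, slant_tangent_unit, slant_normal_unit by exact HA.
    split; [|split; [trivial|split; [|split; [trivial|split; [trivial|]]]]].
    - apply (is_vderive_ext_open a b
        (fun u => plus (f (0, 0, 0)) (A (X u, Y u, Z u)))); trivial.
      + intros u Hu. rewrite Ea, Eb, (Ef (X u, _, _)) by assumption.
        apply (f_equal (plus _)).
        unfold A. by_coords.
      + assert (D := is_vderive_from_const_frame e1 (scal eps e2) (scal eps e3)
          _ _ _ (is_vderive_tuple X Y Z s _ _ _ (DX s Hs) (DY s Hs) (DZ s Hs))).
        destruct D as (D1 & D2 & D3).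
        split; [|split]; (eapply is_derive_eq;
          [apply is_derive_Rplus; [apply is_derive_Rconst|eassumption]|
           apply Rplus_0_l]).
    - replace (scal (kappa s) _) with (from_frame e1 (scal eps e2) (scal eps e3)
        (scal (kappa s) (slant_normal m (phi s)))).
      + now apply is_vderive_from_const_frame.
      + generalize (slant_normal m (phi s)). intros; by_coords.
    - exact (is_vderive_ex _ _ _ (is_vderive_from_const_frame _ _ _ _ _ _
        (vDerive_correct _ _ Dn))). }
  set (d := A (0, 0, 1)).
  assert (Hd : dot d d = 1).
  { unfold d, A. rewrite dot_from_frame by exact HA. by_coords. }
  assert (Hnd : forall s, in_open a b s -> dot (normal alpha s) d = m / c).
  { intros s Hs. rewrite En by trivial. unfold d, A.
    rewrite dot_from_frame by exact HA.
    unfold slant_normal, dot; cbv zeta. autorewrite with coords. fold c. ring. }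
  split.
  - split; trivial. exists d, (acos (m / c)). split; [now apply enorm_eq_1|].
    intros s Hs. rewrite Hnd by trivial. symmetry. apply cos_acos.
    assert (E : (m / c) ^ 2 <= 1).
    { replace ((m / c) ^ 2) with (1 - / c ^ 2).
      - assert (0 < / c ^ 2) by (apply Rinv_0_lt_compat; nra). lra.
      - transitivity ((c ^ 2 - 1) / c ^ 2); [field; lra|].
        rewrite Ec at 1. field; lra. }
    split; nra.
  - rewrite (constant_tau_kappa_iff a b alpha d (m / c) s0 Ha Hs0 Hd Hnd).
    unfold Rdiv. apply Rmult_integral_contrapositive_currified; trivial.
    apply Rinv_neq_0_compat; lra.
Qed.

Theorem theorem0p8 (a b : Rbar) (hab : Rbar_lt a b) (alpha : R -> E3) :
  slant_helix a b alpha /\ ~ constant_tau_kappa a b alpha <->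
  exists (f : E3 -> E3) (beta : R -> E3),
    rigid_motion f /\
    slant_normal_form a b beta /\
    forall s, in_open a b s -> alpha s = f (beta s).
Proof.
  split.
  - intros [Hs Hc]. now apply slant_helix_normal_form.
  - intros (f & beta & [Hf _] & Hb & Ea).
    now apply (normal_form_slant_helix a b alpha beta f).
Qed.
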